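(* Let $\mathbb S$ and $\mathbb S'$ be Gr-categories of type $(\Pi,A,h)$ and $(\Pi',A',h')$ respectively. Then every Gr-functor $(F,\widetilde F):\mathbb S\to\mathbb S'$ is of type $(\varphi,f)$ for some pair of group homomorphisms $\varphi:\Pi\to\Pi'$, $f:A\to A'$ satisfying $f(xa)=\varphi(x)f(a)$ for all $x\in\Pi$, $a\in A$.
   Context: A Gr-category is a monoidal category in which every object is invertible and every morphism is an isomorphism; a Gr-functor $(F,\widetilde F)$ is a monoidal functor between Gr-categories, with natural isomorphisms $\widetilde F_{X,Y}:FX\otimes FY\to F(X\otimes Y)$ and an isomorphism $F_*:I'\to FI$ compatible with associativity and unit constraints. For a group $\Pi$, a $\Pi$-module $A$ and a normalized 3-cocycle $h\in Z^3(\Pi,A)$, the Gr-category of type $(\Pi,A,h)$ has objects $x\in\Pi$, morphisms only the automorphisms $(x,a):x\to x$ with $a\in A$, composition $(x,a)(x,b)=(x,a+b)$, tensor product $x\otimes y=xy$, $(x,a)\otimes(y,b)=(xy,a+xb)$, identity unit constraints, and associativity constraint $(xyz,h(x,y,z)):x\otimes(y\otimes z)\to(x\otimes y)\otimes z$. A functor $F:\mathbb S\to\mathbb S'$ is of type $(\varphi,f)$ if $F(x)=\varphi(x)$ and $F(x,a)=(\varphi(x),f(a))$ for all $x\in\Pi$, $a\in A$, where $\varphi:\Pi\to\Pi'$ and $f:A\to A'$ are group homomorphisms with $f(xa)=\varphi(x)f(a)$. *)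

(* Defs.v *)
From mathcomp Require Import all_boot all_algebra.

Set Implicit Arguments.
Unset Strict Implicit.
Unset Printing Implicit Defensive.

Import GRing.Theory.
Local Open Scope ring_scope.

Declare Scope cat_scope.
Delimit Scope cat_scope with cat.

Record category := Category {
  obj :> Type;
  mor : obj -> obj -> Type;
  idm : forall X, mor X X;
  compm : forall X Y Z, mor Y Z -> mor X Y -> mor X Z;
  compm_idl : forall X Y (u : mor X Y), compm (idm Y) u = u;
  compm_idr : forall X Y (u : mor X Y), compm u (idm X) = u;
  compmA : forall X Y Z T (w : mor Z T) (v : mor Y Z) (u : mor X Y),
    compm w (compm v u) = compm (compm w v) u
}.
Arguments idm {c} X.

Notation "v '\oc' u" := (compm v u) (at level 50, left associativity) : cat_scope.
Local Open Scope cat_scope.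

Definition is_iso (C : category) (X Y : C) (u : mor X Y) : Prop :=
  exists v : mor Y X, v \oc u = idm X /\ u \oc v = idm Y.

Definition isomorphic (C : category) (X Y : C) : Prop :=
  exists u : mor X Y, is_iso u.

Record functor (C D : category) := Functor {
  fobj :> C -> D;
  fhom : forall X Y, mor X Y -> mor (fobj X) (fobj Y);
  fhom_id : forall X, fhom (idm X) = idm (fobj X);
  fhom_comp : forall X Y Z (v : mor Y Z) (u : mor X Y),
    fhom (v \oc u) = fhom v \oc fhom u
}.

(* The associativity constraint goes from X (x) (Y (x) Z) to (X (x) Y) (x) Z. *)
Record monoidal_category := MonoidalCategory {
  mcat :> category;
  tens : mcat -> mcat -> mcat;
  tensh : forall X X' Y Y' : mcat,
    mor X X' -> mor Y Y' -> mor (tens X Y) (tens X' Y');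
  tensh_id : forall X Y : mcat, tensh (idm X) (idm Y) = idm (tens X Y);
  tensh_comp : forall (X X' X'' Y Y' Y'' : mcat)
      (u' : mor X' X'') (u : mor X X') (v' : mor Y' Y'') (v : mor Y Y'),
    tensh (u' \oc u) (v' \oc v) = tensh u' v' \oc tensh u v;
  unit_obj : mcat;
  assoc : forall X Y Z : mcat, mor (tens X (tens Y Z)) (tens (tens X Y) Z);
  lunit : forall X : mcat, mor (tens unit_obj X) X;
  runit : forall X : mcat, mor (tens X unit_obj) X;
  assoc_iso : forall X Y Z, is_iso (assoc X Y Z);
  lunit_iso : forall X, is_iso (lunit X);
  runit_iso : forall X, is_iso (runit X);
  assoc_nat : forall (X X' Y Y' Z Z' : mcat)
      (u : mor X X') (v : mor Y Y') (w : mor Z Z'),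
    assoc X' Y' Z' \oc tensh u (tensh v w)
    = tensh (tensh u v) w \oc assoc X Y Z;
  lunit_nat : forall (X X' : mcat) (u : mor X X'),
    lunit X' \oc tensh (idm unit_obj) u = u \oc lunit X;
  runit_nat : forall (X X' : mcat) (u : mor X X'),
    runit X' \oc tensh u (idm unit_obj) = u \oc runit X;
  pentagon : forall X Y Z T : mcat,
    assoc (tens X Y) Z T \oc assoc X Y (tens Z T)
    = tensh (assoc X Y Z) (idm T)
      \oc assoc X (tens Y Z) T
      \oc tensh (idm X) (assoc Y Z T);
  triangle : forall X Y : mcat,
    tensh (runit X) (idm Y) \oc assoc X unit_obj Y = tensh (idm X) (lunit Y)
}.
Arguments unit_obj {m}.

Notation "X '\ox' Y" := (tens X Y) (at level 40, left associativity) : cat_scope.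
Notation "u '\oxh' v" := (tensh u v) (at level 40, left associativity) : cat_scope.

Definition invertible_obj (C : monoidal_category) (X : C) : Prop :=
  exists Y : C,
    isomorphic (X \ox Y) unit_obj /\ isomorphic (Y \ox X) unit_obj.

Record gr_category := GrCategory {
  gr_mcat :> monoidal_category;
  gr_invertible : forall X : gr_mcat, invertible_obj X;
  gr_iso : forall (X Y : gr_mcat) (u : mor X Y), is_iso u
}.

(* mf_tens is the family F~_{X,Y} and mf_unit is F_* *)
Record monoidal_functor (C D : monoidal_category) := MonoidalFunctor {
  mf_functor :> functor C D;
  mf_tens : forall X Y : C,
    mor (mf_functor X \ox mf_functor Y) (mf_functor (X \ox Y));
  mf_unit : mor (@unit_obj D) (mf_functor unit_obj);
  mf_tens_iso : forall X Y, is_iso (mf_tens X Y);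
  mf_unit_iso : is_iso mf_unit;
  mf_tens_nat : forall (X X' Y Y' : C) (u : mor X X') (v : mor Y Y'),
    mf_tens X' Y' \oc (fhom mf_functor u \oxh fhom mf_functor v)
    = fhom mf_functor (u \oxh v) \oc mf_tens X Y;
  mf_assoc : forall X Y Z : C,
    fhom mf_functor (assoc X Y Z)
      \oc mf_tens X (Y \ox Z)
      \oc (idm (mf_functor X) \oxh mf_tens Y Z)
    = mf_tens (X \ox Y) Z
      \oc (mf_tens X Y \oxh idm (mf_functor Z))
      \oc assoc (mf_functor X) (mf_functor Y) (mf_functor Z);
  mf_lunit : forall X : C,
    fhom mf_functor (lunit X)
      \oc mf_tens unit_obj X
      \oc (mf_unit \oxh idm (mf_functor X))
    = lunit (mf_functor X);
  mf_runit : forall X : C,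
    fhom mf_functor (runit X)
      \oc mf_tens X unit_obj
      \oc (idm (mf_functor X) \oxh mf_unit)
    = runit (mf_functor X)
}.

Definition gr_functor (S S' : gr_category) := monoidal_functor S S'.

(* The library has no modules over a (possibly infinite) group. *)
Record group_action (G : groupType) (A : zmodType) := GroupAction {
  act :> G -> A -> A;
  act1 : forall a, act 1%g a = a;
  actM : forall x y a, act (x * y)%g a = act x (act y a);
  actD : forall x a b, act x (a + b) = act x a + act x b
}.

Record cocycle3 (G : groupType) (A : zmodType) (M : group_action G A) :=
  Cocycle3 {
  coc :> G -> G -> G -> A;
  cocP : forall x y z t,
    M x (coc y z t) - coc (x * y)%g z t + coc x (y * z)%g t
      - coc x y (z * t)%g + coc x y z = 0;
  coc_1l : forall y z, coc 1%g y z = 0;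
  coc_1m : forall x z, coc x 1%g z = 0;
  coc_1r : forall x y, coc x y 1%g = 0
}.

Section Reduced.
Variables (G : groupType) (A : zmodType).
Implicit Types (x y z t : G) (a b : A).

(* A morphism x -> y is an element of A together with a proof of x = y: there
   is none when x and y differ, and the morphisms x -> x are the pairs (x, a).
   Carrying the equation allows associativity constraints between objects that
   are equal but not convertible. *)
Record red_hom (x y : G) := RedHom { red_eq : x = y; red_lab : A }.

Definition red_pair x a : red_hom x x := RedHom (erefl x) a.

Lemma red_homP x y (u v : red_hom x y) : red_lab u = red_lab v -> u = v.
Proof.
case: u v => [e a] [e' b] /= ->.
by rewrite (eq_irrelevance e e').
Qed.

Definition red_comp x y z (v : red_hom y z) (u : red_hom x y) : red_hom x z :=
  RedHom (etrans (red_eq u) (red_eq v)) (red_lab v + red_lab u).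

Lemma red_comp_idl x y (u : red_hom x y) : red_comp (red_pair y 0) u = u.
Proof. by apply: red_homP; rewrite /= add0r. Qed.

Lemma red_comp_idr x y (u : red_hom x y) : red_comp u (red_pair x 0) = u.
Proof. by apply: red_homP; rewrite /= addr0. Qed.

Lemma red_compA x y z t
    (w : red_hom z t) (v : red_hom y z) (u : red_hom x y) :
  red_comp w (red_comp v u) = red_comp (red_comp w v) u.
Proof. by apply: red_homP; rewrite /= addrA. Qed.

Definition red_category : category :=
  @Category G red_hom (fun x => red_pair x 0) red_comp
    red_comp_idl red_comp_idr red_compA.

Lemma red_is_iso (x y : red_category) (u : mor x y) : is_iso u.
Proof.
exists (RedHom (esym (red_eq u)) (- red_lab u)).
by split; apply: red_homP; rewrite /= ?addNr ?addrN.
Qed.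

Variables (M : group_action G A) (h : cocycle3 M).

Lemma act0 x : M x 0 = 0.
Proof. by apply: (@addrI _ (M x 0)); rewrite -actD !addr0. Qed.

Definition red_tensh x x' y y' (u : red_hom x x') (v : red_hom y y') :
    red_hom (x * y)%g (x' * y')%g :=
  RedHom (congr2 (fun s t => (s * t)%g) (red_eq u) (red_eq v))
    (red_lab u + M x (red_lab v)).

Lemma red_tensh_id x y :
  red_tensh (red_pair x 0) (red_pair y 0) = red_pair (x * y)%g 0.
Proof. by apply: red_homP; rewrite /= act0 addr0. Qed.

Lemma red_tensh_comp x x' x'' y y' y''
    (u' : red_hom x' x'') (u : red_hom x x')
    (v' : red_hom y' y'') (v : red_hom y y') :
  red_tensh (red_comp u' u) (red_comp v' v)
  = red_comp (red_tensh u' v') (red_tensh u v).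
Proof.
apply: red_homP => /=; case: u u' => [e a]; case: x' / e => u' /=.
by rewrite actD addrACA.
Qed.

Definition red_assoc x y z : red_hom (x * (y * z))%g ((x * y) * z)%g :=
  RedHom (mulgA x y z) (h x y z).

Definition red_lunit x : red_hom (1 * x)%g x := RedHom (mul1g x) 0.
Definition red_runit x : red_hom (x * 1)%g x := RedHom (mulg1 x) 0.

Lemma red_assoc_nat x x' y y' z z'
    (u : red_hom x x') (v : red_hom y y') (w : red_hom z z') :
  red_comp (red_assoc x' y' z') (red_tensh u (red_tensh v w))
  = red_comp (red_tensh (red_tensh u v) w) (red_assoc x y z).
Proof.
apply: red_homP => /=; case: u v w => [eu a] [ev b] [ew c] /=.
case: _ / eu; case: _ / ev; case: _ / ew.
by rewrite actD actM addrC !addrA.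
Qed.

Lemma red_lunit_nat x x' (u : red_hom x x') :
  red_comp (red_lunit x') (red_tensh (red_pair 1%g 0) u)
  = red_comp u (red_lunit x).
Proof. by apply: red_homP; rewrite /= act1 !add0r addr0. Qed.

Lemma red_runit_nat x x' (u : red_hom x x') :
  red_comp (red_runit x') (red_tensh u (red_pair 1%g 0))
  = red_comp u (red_runit x).
Proof. by apply: red_homP; rewrite /= act0 !addr0 add0r. Qed.

Lemma red_pentagon x y z t :
  red_comp (red_assoc (x * y)%g z t) (red_assoc x y (z * t)%g)
  = red_comp
      (red_comp (red_tensh (red_assoc x y z) (red_pair t 0))
                (red_assoc x (y * z)%g t))
      (red_tensh (red_pair x 0) (red_assoc y z t)).
Proof.
apply: red_homP => /=; rewrite act0 addr0 add0r.
apply/esym/subr0_eq; rewrite -[RHS](cocP h x y z t) opprD !addrA.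
by rewrite [LHS](ACl (3*4*2*5*1)).
Qed.

Lemma red_triangle x y :
  red_comp (red_tensh (red_runit x) (red_pair y 0)) (red_assoc x 1%g y)
  = red_tensh (red_pair x 0) (red_lunit y).
Proof. by apply: red_homP; rewrite /= coc_1m !act0 !addr0. Qed.

Definition red_monoidal : monoidal_category :=
  @MonoidalCategory red_category (fun x y => (x * y)%g) red_tensh
    red_tensh_id red_tensh_comp 1%g red_assoc red_lunit red_runit
    (fun x y z => red_is_iso _) (fun x => red_is_iso _) (fun x => red_is_iso _)
    red_assoc_nat red_lunit_nat red_runit_nat red_pentagon red_triangle.

Lemma red_invertible (x : red_monoidal) : invertible_obj x.
Proof.
exists (x^-1)%g; split.
- by exists (RedHom (mulgV x) 0); apply: red_is_iso.
- by exists (RedHom (mulVg x) 0); apply: red_is_iso.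
Qed.

(* the Gr-category of type (G, A, h) *)
Definition red_gr_category : gr_category :=
  @GrCategory red_monoidal red_invertible red_is_iso.

End Reduced.

(* Morphisms F x -> F x and phi x -> phi x live in different types, so they are
   compared together with their source and target. *)
Record arrow (C : category) := Arrow { src : C; tgt : C; arr : mor src tgt }.

Definition functor_of_type (G G' : groupType) (A A' : zmodType)
    (M : group_action G A) (M' : group_action G' A')
    (h : cocycle3 M) (h' : cocycle3 M')
    (F : functor (red_gr_category h) (red_gr_category h'))
    (phi : {multiplicative G -> G'}) (f : {additive A -> A'}) : Prop :=
  [/\ forall x a, f (M x a) = M' (phi x) (f a),
      forall x : G, F x = phi x
    & forall (x : G) (a : A),
        @Arrow (red_gr_category h') _ _ (fhom F (red_pair x a))
        = @Arrow (red_gr_category h') _ _ (red_pair (phi x) (f a))].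

(* Main.v *)
(* Morphisms of S' exist only between equal objects, so the isomorphisms F~_{x,y}
   already make F multiplicative on objects.  Write F(x, a) = (F x, f_x a).
   Functoriality makes f_x additive; naturality of F~_{x,y}, whose label cancels,
   reads f_{xy}(a + x b) = f_x(a) + F(x) f_y(b).  Taking x = 1 and b = 0 shows that
   f_x does not depend on x, and a = 0 then gives equivariance. *)

Require Import Defs.
From mathcomp Require Import all_boot all_algebra.
From HB Require Import structures.

Import GRing.Theory.
Local Open Scope ring_scope.
Local Open Scope cat_scope.

Section Label.
Context {G G' : groupType} {A A' : zmodType}.
Context {M : group_action G A} {M' : group_action G' A'}.
Context {h : cocycle3 M} {h' : cocycle3 M'}.
Variable F : gr_functor (red_gr_category h) (red_gr_category h').

Lemma fobjM : {morph (F : G -> G') : x y / (x * y)%g}.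
Proof. by move=> x y; exact: esym (red_eq (mf_tens F x y)). Qed.

(** This is $f_x$. Labels lie in [A'] whatever the endpoints, so the maps at different [x] can be
    compared. *)
Definition fhom_lab (x : G) (a : A) : A' :=
  red_lab (fhom F (red_pair x a : mor (x : red_gr_category h) x)).

Lemma fhom_labD x : {morph fhom_lab x : a b / a + b}.
Proof.
move=> a b; rewrite /fhom_lab.
have -> : red_pair x (a + b)
    = (red_pair x a : mor (x : red_gr_category h) x) \oc red_pair x b.
  exact: red_homP.
by rewrite fhom_comp.
Qed.

Lemma fhom_lab0 x : fhom_lab x 0 = 0.
Proof. by apply: (@addrI _ (fhom_lab x 0)); rewrite -fhom_labD !addr0. Qed.

Lemma fhom_lab_tens x y a b :
  fhom_lab (x * y)%g (a + M x b) = fhom_lab x a + M' (F x) (fhom_lab y b).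
Proof.
have /(congr1 (@red_lab _ _ _ _)) /= :=
  mf_tens_nat F (red_pair x a : mor (x : red_gr_category h) x)
    (red_pair y b : mor (y : red_gr_category h) y).
rewrite addrC => /addIr ->; rewrite /fhom_lab.
(* The tensor of the two pairs and the pair on [x * y] differ only in their proof of equality of
   endpoints. *)
by congr (red_lab (fhom F _)); apply: red_homP.
Qed.

Lemma fhom_lab_const x a : fhom_lab x a = fhom_lab 1%g a.
Proof.
have := fhom_lab_tens 1%g x a 0.
by rewrite mul1g fhom_lab0 !act0 !addr0.
Qed.

Lemma fhom_lab_act x a : fhom_lab 1%g (M x a) = M' (F x) (fhom_lab 1%g a).
Proof.
have := fhom_lab_tens x 1%g 0 a.
by rewrite mulg1 fhom_lab0 !add0r fhom_lab_const.
Qed.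

(** Additivity in the form used to build [f]: adding back the image of [b] reduces differences to
    sums. *)
Lemma fhom_lab_zmod_morphism : zmod_morphism (fhom_lab 1%g).
Proof.
by move=> a b; apply: (@addIr _ (fhom_lab 1%g b)); rewrite -fhom_labD !subrK.
Qed.

End Label.

Theorem theorem2p5 (G G' : groupType) (A A' : zmodType)
    (M : group_action G A) (M' : group_action G' A')
    (h : cocycle3 M) (h' : cocycle3 M')
    (F : gr_functor (red_gr_category h) (red_gr_category h')) :
  exists (phi : {multiplicative G -> G'}) (f : {additive A -> A'}),
    (forall (x : G) (a : A), f (M x a) = M' (phi x) (f a))
    /\ functor_of_type F phi f.
Proof.
pose FMmix := isMultiplicative.Build G G' (F : G -> G') (fobjM F).
pose phi : {multiplicative G -> G'} := HB.pack (F : G -> G') FMmix.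
pose fmix := GRing.isZmodMorphism.Build A A' _ (fhom_lab_zmod_morphism F).
pose f : {additive A -> A'} := HB.pack (fhom_lab F 1%g) fmix.
have f_act x a : f (M x a) = M' (phi x) (f a) by exact: fhom_lab_act.
exists phi, f; split=> //; split=> // x a.
(* As [phi] is by definition [F] on objects, both arrows have the same endpoints and only labels
   remain. *)
congr Arrow; apply: red_homP; exact: fhom_lab_const.
Qed.
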